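(* For every integer $n \ge 4$ and every real $t > 1$, there exists a totally positive real $n \times n$ matrix $A$ such that $A^{\circ t}$ is not TN$_4$.
   Context: A real matrix is totally positive if every minor (determinant of a square submatrix, of any size) is positive; it is TN$_r$ (totally nonnegative of order $r$) if every minor of size $\le r$ is nonnegative. For a matrix $A=(a_{ij})$ with nonnegative real entries and real $t>0$, the Hadamard (entrywise) power is $A^{\circ t}=(a_{ij}^t)$. *)

(* Defs.v *)
From mathcomp Require Import all_boot all_order all_algebra.
From mathcomp Require Import reals exp.

Set Implicit Arguments.
Unset Strict Implicit.
Unset Printing Implicit Defensive.

Import Order.TTheory GRing.Theory Num.Theory.

Local Open Scope ring_scope.

Definition strictly_increasing (k n : nat) (f : 'I_k -> 'I_n) : Prop :=
  forall i j : 'I_k, (i < j)%N -> (f i < f j)%N.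

(* In the two predicates below, k = 0 only adds the empty minor, which is 1. *)

Definition totally_positive (R : numDomainType) (m n : nat)
    (A : 'M[R]_(m, n)) : Prop :=
  forall (k : nat) (f : 'I_k -> 'I_m) (g : 'I_k -> 'I_n),
    strictly_increasing f -> strictly_increasing g ->
    0 < \det (mxsub f g A).

Definition totally_nonnegative_of_order (R : numDomainType) (r m n : nat)
    (A : 'M[R]_(m, n)) : Prop :=
  forall (k : nat) (f : 'I_k -> 'I_m) (g : 'I_k -> 'I_n),
    (k <= r)%N -> strictly_increasing f -> strictly_increasing g ->
    0 <= \det (mxsub f g A).

(* Meaningful for entrywise nonnegative A, which includes every totally
   positive A (1 x 1 minors): powR takes junk values at negative bases. *)
Definition hadamard_power (R : realType) (m n : nat) (A : 'M[R]_(m, n))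
    (t : R) : 'M[R]_(m, n) :=
  map_mx (fun a => powR a t) A.

(* Main.v *)
Require Import Defs.
From mathcomp Require Import all_boot all_order all_fingroup all_algebra.
From mathcomp Require Import all_classical all_reals all_analysis.
From mathcomp Require Import ring lra.

(** Consider F(u, v) = 1 + uv + (u^2 - u^3)(v^2 + N v^3) + u^3 v^3 and sample it
    at the points (e x_i, e x_j) for small e > 0.  The leading term in e of a
    4 x 4 determinant of such samples is a positive multiple of the determinant
    of the coefficients of u^a v^b, a, b < 4.  For F itself the sampled matrix
    factors as P diag(1, e^2, e^4, e^6) Q, where P and Q tend to the Vandermonde
    matrix of x and its transpose; both are totally positive for small e, hence
    so is their product by Cauchy-Binet.  For F^t the coefficient determinant is
    affine in N, with slope - t^2 C(t, 2) < 0, so it is negative for large N.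
    The 4 x 4 example is extended to an n x n one by adding rows
    (1, y, y^2, ...), and then columns, with y large enough. *)

Set Implicit Arguments.
Unset Strict Implicit.
Unset Printing Implicit Defensive.

Import Order.TTheory GRing.Theory Num.Theory numFieldNormedType.Exports.

Local Open Scope ring_scope.
Local Open Scope classical_set_scope.

(** * Products of totally positive matrices *)

Lemma strictly_increasing_inj k n (f : 'I_k -> 'I_n) :
  strictly_increasing f -> injective f.
Proof.
move=> fi i j fij; apply: val_inj => /=.
by case: (ltngtP i j) => // /fi; rewrite fij ltnn.
Qed.

Lemma strictly_increasing_leq k n (f : 'I_k -> 'I_n) :
  strictly_increasing f -> (k <= n)%N.
Proof.
by move=> /strictly_increasing_inj /leq_card; rewrite !card_ord.
Qed.

(** Sorting the values of [f] yields the permutation; injectivity rules out ties. *)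
Lemma strictly_increasing_perm k n (f : 'I_k -> 'I_n) :
  injective f -> exists s : 'S_k, strictly_increasing (f \o s).
Proof.
move=> fI; pose t := [tuple f i | i < k].
pose r := [rel x y : 'I_n | (x <= y)%N].
have rtot : total r by move=> x y; exact: leq_total.
have rtr : transitive r by move=> x y z; exact: leq_trans.
have /tuple_permP[s Es] : perm_eq (sort_tuple r t) t by rewrite perm_sort.
exists s => i j ij /=.
have szt : size (sort r t) = k by rewrite size_sort size_tuple.
have E (l : 'I_k) : nth (f i) (sort r t) l = f (s l).
  by rewrite -[sort r t]/(tval (sort_tuple r t)) Es -tnth_nth !tnth_mktuple.
have ut : uniq (sort r t) by rewrite sort_uniq map_inj_uniq ?enum_uniq.
have : (nth (f i) (sort r t) i <= nth (f i) (sort r t) j)%N.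
  apply: (sorted_leq_nth rtr) => //; rewrite ?inE ?szt ?ltn_ord ?(ltnW ij) //.
  exact: sort_sorted.
rewrite !E leq_eqVlt => /orP[/eqP/val_inj/fI/perm_inj e|//].
by rewrite e ltnn in ij.
Qed.

(* Summing over all maps f instead of the increasing ones counts every term of
   the Cauchy-Binet formula k! times and the non-injective f contribute 0. *)
Lemma det_mulmx_fact (R : comNzRingType) k n (A : 'M[R]_(k, n))
    (B : 'M[R]_(n, k)) :
  \det (A *m B) *+ k`! =
  \sum_(f : {ffun 'I_k -> 'I_n}) \det (mxsub id f A) * \det (mxsub f id B).
Proof.
have detE : \det (A *m B) = \sum_(f : {ffun 'I_k -> 'I_n})
    (\prod_i A i (f i)) * \det (mxsub f id B).
  transitivity (\sum_(s : 'S_k) \sum_(f : {ffun 'I_k -> 'I_n})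
      (-1) ^+ s * \prod_i (A i (f i) * B (f i) (s i))).
    apply: eq_bigr => s _; rewrite -big_distrr /=; congr (_ * _).
    rewrite -(bigA_distr_bigA (fun i j => A i j * B j (s i))) /=.
    by apply: eq_bigr => i _; rewrite mxE.
  rewrite exchange_big; apply: eq_bigr => f _ /=.
  rewrite big_distrr; apply: eq_bigr => s _ /=.
  rewrite big_split /= mulrCA; congr (_ * (_ * _)).
  by apply: eq_bigr => i _; rewrite mxE.
(* Replacing [f] by [f \o s] permutes the rows of the [B] minor and brings out its sign. Summing
   over all [s] then assembles the [A] minor. *)
have detEs (s : 'S_k) : \det (A *m B) = \sum_(f : {ffun 'I_k -> 'I_n})
    ((-1) ^+ s * \prod_i A i (f (s i))) * \det (mxsub f id B).
  pose h (s : 'S_k) (f : {ffun 'I_k -> 'I_n}) := [ffun i => f (s i)].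
  have hK (u : 'S_k) : cancel (h u) (h u^-1%g).
    by move=> f; apply/ffunP=> i; rewrite !ffunE permKV.
  rewrite detE (reindex_inj (can_inj (hK s))); apply: eq_bigr => f _ /=.
  have -> : mxsub (h s f) id B = perm_mx s *m mxsub f id B.
    by rewrite -row_permE; apply/matrixP => i j; rewrite !mxE ffunE.
  rewrite det_mulmx det_perm mulrA; congr (_ * _); rewrite mulrC.
  by congr (_ * _); apply: eq_bigr => i _; rewrite ffunE.
have -> : \det (A *m B) *+ k`! = \sum_(s : 'S_k) \det (A *m B).
  by rewrite sumr_const card_Sn.
under eq_bigr => s _ do rewrite (detEs s).
rewrite exchange_big; apply: eq_bigr => f _ /=.
rewrite -big_distrl; congr (_ * _); apply: eq_bigr => s _.
congr (_ * _).
by apply: eq_bigr => i _; rewrite mxE.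
Qed.

(** No term of the Cauchy-Binet sum is negative: a non-injective map repeats a row, and sorting an
    injective one changes both minors by the same sign. The bound [m <= n] provides an increasing
    map, whose term is positive. *)
Lemma totally_positive_mulmx (R : numDomainType) m n p (A : 'M[R]_(m, n))
    (B : 'M[R]_(n, p)) : (m <= n)%N ->
  totally_positive A -> totally_positive B -> totally_positive (A *m B).
Proof.
move=> lemn Apos Bpos k f g fi gi.
have idi : strictly_increasing (id : 'I_k -> 'I_k) by [].
have lekn : (k <= n)%N := leq_trans (strictly_increasing_leq fi) lemn.
rewrite mxsub_mul -(pmulrn_lgt0 _ (fact_gt0 k)) det_mulmx_fact.
have subP (h : 'I_k -> 'I_n) : strictly_increasing h ->
    0 < \det (mxsub id h (rowsub f A)) * \det (mxsub h id (colsub g B)).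
  by move=> hi; rewrite -!mxsub_comp mulr_gt0 //; [apply: Apos|apply: Bpos].
rewrite (bigD1 (finfun (widen_ord lekn))) //= ltr_pwDl //.
  by apply: subP => i j; rewrite !ffunE.
apply: sumr_ge0 => h _.
have [/injectiveP hI|/injectivePn [i [j ij hij]]] := boolP (injectiveb h).
  have [s /subP] := strictly_increasing_perm hI.
  have -> : mxsub id (h \o s) (rowsub f A) =
      mxsub id h (rowsub f A) *m perm_mx s^-1.
    by rewrite -col_permE; apply/matrixP => i j; rewrite !mxE.
  have -> : mxsub (h \o s) id (colsub g B) =
      perm_mx s *m mxsub h id (colsub g B).
    by rewrite -row_permE; apply/matrixP => i j; rewrite !mxE.
  rewrite !det_mulmx !det_perm odd_permV -mulrA (mulrA (_ ^+ _)).
  by rewrite -expr2 sqrr_sign mul1r => /ltW.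
rewrite [X in _ * X](determinant_alternate ij) ?mulr0 // => l.
by rewrite !mxE hij.
Qed.

Lemma totally_positive_tr (R : numDomainType) m n (A : 'M[R]_(m, n)) :
  totally_positive A -> totally_positive A^T.
Proof. by move=> Apos k f g fi gi; rewrite -trmx_mxsub det_tr; apply: Apos. Qed.

Lemma totally_positive_mul_diag (R : numDomainType) m n (A : 'M[R]_(m, n))
    (d : 'rV[R]_n) : (forall j, 0 < d 0 j) ->
  totally_positive A -> totally_positive (A *m diag_mx d).
Proof.
move=> dpos Apos k f g fi gi.
have -> : mxsub f g (A *m diag_mx d) =
    mxsub f g A *m diag_mx (\row_j d 0 (g j)).
  by rewrite !mul_mx_diag; apply/matrixP => i j; rewrite !mxE.
rewrite det_mulmx det_diag mulr_gt0 ?Apos // prodr_gt0 // => i _.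
by rewrite mxE.
Qed.

(** * Totally positive matrices by adding rows *)

(** There are only finitely many minors, since [k <= m]. Finite functions replace [f] and [g] so
    that the quantifiers range over finite types. *)
Lemma near_totally_positive (R : numDomainType) T (F : set_system T)
    (FF : Filter F) m n (M : T -> 'M[R]_(m, n)) :
  (forall k (f : 'I_k -> 'I_m) (g : 'I_k -> 'I_n),
    strictly_increasing f -> strictly_increasing g ->
    \forall x \near F, 0 < \det (mxsub f g (M x))) ->
  \forall x \near F, totally_positive (M x).
Proof.
move=> H.
have : \forall x \near F, forall (k : 'I_m.+1) (f : {ffun 'I_k -> 'I_m})
    (g : {ffun 'I_k -> 'I_n}), strictly_increasing f ->
    strictly_increasing g -> 0 < \det (mxsub f g (M x)).
  apply: filter_forall => k; apply: filter_forall => f.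
  apply: filter_forall => g.
  have [[fi gi]|nfg] :=
    pselect (strictly_increasing f /\ strictly_increasing g).
    by apply: filterS (H k f g fi gi).
  by apply: nearW => x fi gi; case: nfg.
apply: filterS => x Hx k f g fi gi.
have km : (k < m.+1)%N by rewrite ltnS (strictly_increasing_leq fi).
rewrite -mxsub_ffun.
by apply: (Hx (Ordinal km)) => i j ij; rewrite !ffunE; [apply: fi|apply: gi].
Qed.

Lemma near_pinfty_sum_gt0 (R : realType) k (c : 'I_k.+1 -> R)
    (e : 'I_k.+1 -> nat) :
  (forall i j : 'I_k.+1, (i < j)%N -> (e i < e j)%N) -> 0 < c ord_max ->
  \forall x \near +oo, 0 < \sum_j c j * x ^+ e j.
Proof.
case: k c e => [|k] c e ei cpos.
  near=> x; have x0 : 0 < x by near: x; exact: (nbhs_pinfty_gt (num_real _)).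
  by rewrite big_ord_recr big_ord0 /= add0r mulr_gt0 ?exprn_gt0.
(* For [x >= 1] the lower terms add up to at most [s * x ^+ d], where [d.+1] is the top exponent;
   the top term wins once [c ord_max * x > s]. *)
set s := \sum_(j < k.+1) `|c (widen_ord (leqnSn k.+1) j)|.
near=> x.
have x1 : 1 <= x by near: x; exact: (nbhs_pinfty_ge (num_real _)).
have sx : s / c ord_max < x by near: x; exact: (nbhs_pinfty_gt (num_real _)).
have x0 : 0 < x := lt_le_trans ltr01 x1.
rewrite big_ord_recr /=.
have [d De] : exists d, e ord_max = d.+1.
  by case E: (e ord_max) (ei ord0 ord_max isT) => [//|d] _; exists d.
rewrite De exprS mulrA.
have : `|\sum_(j < k.+1) c (widen_ord (leqnSn k.+1) j) *
    x ^+ e (widen_ord (leqnSn k.+1) j)| <= s * x ^+ d.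
  rewrite big_distrl; apply: le_trans (ler_norm_sum _ _ _) _.
  apply: ler_sum => j _; rewrite normrM ler_wpM2l //.
  rewrite ger0_norm ?exprn_ge0 ?(ltW x0) // ler_weXn2l // -ltnS -De.
  by apply: ei; rewrite /= ltn_ord.
have : s * x ^+ d < c ord_max * x * x ^+ d.
  by rewrite ltr_pM2r ?exprn_gt0 // -ltr_pdivrMl // mulrC.
rewrite ler_norml => ? /andP[] *; lra.
Unshelve. all: by end_near. Qed.

(** Entries are indexed by [nat] so that adding a row or column requires no cast between matrix
    types. *)
Definition tp_nat (R : numDomainType) (m n : nat) (a : nat -> nat -> R) :=
  totally_positive (\matrix_(i < m, j < n) a i j).

(** A minor using the new row is, by expansion along it, a polynomial in [x] whose leading
    coefficient is a minor of [a], hence positive. *)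
Lemma tp_nat_add_row (R : realType) m n (a : nat -> nat -> R) : tp_nat m n a ->
  \forall x \near +oo,
    tp_nat m.+1 n (fun i j => if i == m then x ^+ j else a i j).
Proof.
move=> apos; apply: near_totally_positive => k f g fi gi.
case: k f g fi gi => [|k] f g fi gi.
  by apply: nearW => x; rewrite det_mx00.
set b := fun (x : R) (i j : nat) => if i == m then x ^+ j else a i j.
pose M x : 'M[R]_(k.+1) := mxsub f g (\matrix_(i < m.+1, j < n) b x i j).
have subpos l (f1 : 'I_l -> 'I_m.+1) (g1 : 'I_l -> 'I_n) x :
    strictly_increasing f1 -> strictly_increasing g1 ->
    (forall i, (f1 i < m)%N) ->
    0 < \det (mxsub f1 g1 (\matrix_(i < m.+1, j < n) b x i j)).
  move=> f1i g1i f1m; rewrite [X in \det X](_ : _ =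
      mxsub (fun i => Ordinal (f1m i)) g1 (\matrix_(i < m, j < n) a i j)).
    by apply: apos => // i j ij /=; exact: f1i.
  by apply/matrixP => i j; rewrite !mxE /b ltn_eqF.
have [fm|] := ltnP (f ord_max) m.
  apply: nearW => x; apply: subpos => // i.
  apply: leq_ltn_trans fm; case: (ltnP i k) => [ik|ki].
    exact/ltnW/fi.
  rewrite (_ : i = ord_max) //; apply/val_inj/anti_leq.
  by rewrite ki -ltnS ltn_ord.
move=> fm; have {}fm : f ord_max = m :> nat.
  by apply/anti_leq; rewrite fm -ltnS ltn_ord.
have fl i : (f (lift ord_max i) < m)%N.
  by rewrite -{2}fm; apply: fi; rewrite lift_max.
(* Cofactors along the new row do not depend on [x], so [0] serves as a reference value. *)
have cofE x j : cofactor (M x) ord_max j = cofactor (M 0) ord_max j.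
  congr (_ * \det _); apply/matrixP => i l.
  by rewrite !mxE /b !ltn_eqF.
have detE x : \det (M x) =
    \sum_j cofactor (M 0) ord_max j * x ^+ g j.
  rewrite (expand_det_row _ ord_max); apply: eq_bigr => j _.
  by rewrite mulrC cofE !mxE /b fm eqxx.
have cpos : 0 < cofactor (M 0) ord_max ord_max.
  rewrite /cofactor -signr_odd oddD addbb mul1r.
  rewrite [X in \det X](_ : _ = mxsub (f \o lift ord_max) (g \o lift ord_max)
     (\matrix_(i < m.+1, j < n) b 0 i j)).
    by apply: subpos => // i j ij /=; [apply: fi|apply: gi]; rewrite !lift_max.
  by apply/matrixP => i l; rewrite !mxE.
by under eq_near do rewrite detE; exact: near_pinfty_sum_gt0.
Qed.

Lemma tp_nat_vandermonde (R : realType) m n :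
  exists x : nat -> R, tp_nat m n (fun i j => x i ^+ j).
Proof.
elim: m => [|m [x IH]].
  exists (fun=> 0) => k f g fi _; have := strictly_increasing_leq fi.
  by case: k f g fi => // f g *; rewrite det_mx00.
have [y Hy] := filter_ex (tp_nat_add_row IH).
exists (fun i => if i == m then y else x i); congr (totally_positive _): Hy.
by apply/matrixP => i j; rewrite !mxE; case: ifP.
Qed.

Lemma tp_nat_extend_rows (R : realType) m m' n (a : nat -> nat -> R) :
  (m <= m')%N -> tp_nat m n a ->
  exists2 b, tp_nat m' n b & forall i j, (i < m)%N -> b i j = a i j.
Proof.
move=> lemm apos; elim: m' lemm => [|m' IH].
  by rewrite leqn0 => /eqP mE; exists a => //; rewrite -mE.
rewrite leq_eqVlt => /predU1P[<-|lemm]; first by exists a.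
have [b bpos ba] := IH lemm.
have [y Hy] := filter_ex (tp_nat_add_row bpos).
exists (fun i j => if i == m' then y ^+ j else b i j) => // i j im.
by rewrite ltn_eqF ?ba // (leq_trans im).
Qed.

Lemma tp_nat_tr (R : numDomainType) m n (a : nat -> nat -> R) :
  tp_nat m n a -> tp_nat n m (fun i j => a j i).
Proof.
move=> /totally_positive_tr; congr (totally_positive _).
by apply/matrixP => i j; rewrite !mxE.
Qed.

Lemma tp_nat_extend (R : realType) m n (a : nat -> nat -> R) :
  (m <= n)%N -> tp_nat m m a -> exists2 b, tp_nat n n b &
    forall i j, (i < m)%N -> (j < m)%N -> b i j = a i j.
Proof.
move=> lemn /(tp_nat_extend_rows lemn)[b /tp_nat_tr bpos ba].
have [c /tp_nat_tr cpos cb] := tp_nat_extend_rows lemn bpos.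
by exists (fun i j => c j i) => // i j im jm; rewrite cb ?ba.
Qed.

(** * Total positivity as an open condition *)

Lemma cvg_det (R : realType) T (F : set_system T) (FF : Filter F) n
    (M : T -> 'M[R]_n) (A : 'M[R]_n) :
  (forall i j, M x i j @[x --> F] --> A i j) ->
  \det (M x) @[x --> F] --> \det A.
Proof.
move=> MA; apply: cvg_big => //; first exact: add_continuous.
move=> s _; apply: cvgM; first exact: cvg_cst.
by apply: cvg_big => //; exact: mul_continuous.
Qed.

Lemma near_cvg_totally_positive (R : realType) T (F : set_system T)
    (FF : Filter F) m n (M : T -> 'M[R]_(m, n)) (A : 'M[R]_(m, n)) :
  (forall i j, M x i j @[x --> F] --> A i j) -> totally_positive A ->
  \forall x \near F, totally_positive (M x).
Proof.
move=> MA Apos; apply: near_totally_positive => k f g fi gi.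
apply: cvgr_gt (Apos k f g fi gi); apply: cvg_det => i j.
by under eq_cvg do rewrite mxE; rewrite mxE; exact: MA.
Qed.

(** * Expansion of real powers *)

Definition gbinomial (R : realFieldType) (s : R) (j : nat) : R :=
  (\prod_(i < j) (s - i%:R)) / j`!%:R.

Lemma gbinomialS (R : realFieldType) (s : R) j :
  gbinomial s j.+1 *+ j.+1 = s * gbinomial (s - 1) j.
Proof.
rewrite /gbinomial big_ord_recl subr0.
have -> : \prod_(i < j) (s - (lift ord0 i)%:R) = \prod_(i < j) (s - 1 - i%:R).
  by apply: eq_bigr => i _; rewrite lift0 -natr1; ring.
rewrite factS natrM -mulr_natr; field.
by rewrite addrC natr1 !pnatr_eq0 -lt0n fact_gt0.
Qed.

(** Induction on [k] by the mean value theorem: the derivative of the remainder of order [k.+1] for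
    [s] is [s] times the remainder of order [k] for [s - 1]. *)
Lemma powR_taylor (R : realType) (k : nat) (s : R) :
  exists2 K : R, 0 <= K & forall a, 1 <= a <= 2 ->
    `|a `^ s - \sum_(j < k) gbinomial s j * (a - 1) ^+ j| <= K * (a - 1) ^+ k.
Proof.
elim: k s => [|k IH] s.
  exists (2 `^ `|s|) => [|a /andP[a1 a2]]; first exact: powR_ge0.
  rewrite big_ord0 subr0 expr0 mulr1 ger0_norm ?powR_ge0 //.
  apply: (@le_trans _ _ (a `^ `|s|)); first by rewrite ler_powR ?ler_norm.
  by apply: ge0_ler_powR; rewrite // nnegrE // (le_trans ler01 a1).
have [K K0 HK] := IH (s - 1).
exists (`|s| * K) => [|a /andP[a1 a2]]; first exact: mulr_ge0.
pose p s k : {poly R} := \poly_(j < k) gbinomial s j \Po ('X - 1%:P).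
have pE u l c : (p u l).[c] = \sum_(j < l) gbinomial u j * (c - 1) ^+ j.
  by rewrite horner_comp horner_poly !hornerE.
have dp : deriv (p s k.+1) = s *: p (s - 1) k.
  rewrite deriv_comp derivXsubC mulr1 -comp_polyZ; congr (_ \Po _).
  apply/polyP => j; rewrite coef_deriv coefZ !coef_poly ltnS.
  by case: ifP => _; rewrite ?gbinomialS ?mul0rn ?mulr0.
have der (c : R) : 0 < c ->
    is_derive c 1 ((fun x => x `^ s) - (fun x => (p s k.+1).[x]))
    (s * (c `^ (s - 1) - \sum_(j < k) gbinomial (s - 1) j * (c - 1) ^+ j)).
  move=> c0.
  have := is_deriveB (is_derive1_powR s c0) (is_derive_poly (p s k.+1) c).
  by rewrite dp hornerZ pE -mulrBr.
have pos c : c \in `[1, a]%R -> 0 < c.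
  by rewrite in_itv /= => /andP[/(lt_le_trans ltr01)].
have [|c c1a] :=
  MVT_segment a1 (fun c ci => der c (pos c (subset_itv_oo_cc ci))).
  apply: derivable_within_continuous => c /pos c0.
  exact/ex_derive/der.
move: (c1a); rewrite in_itv /= => /andP[c1 ca].
(* The power and its Taylor polynomial agree at 1, so the increment from 1 to [a] is the remainder
   at [a] itself. *)
have p1 : (p s k.+1).[1] = 1.
  rewrite pE big_ord_recl /= subrr expr0 mulr1 big1 => [|j _].
    by rewrite addr0 /gbinomial big_ord0 divr1.
  by rewrite expr0n mulr0.
rewrite -![(_ - _ : _ -> _) _]/(_ - _) p1 powR1 subrr subr0 pE => ->.
rewrite !normrM.
rewrite [`|a - 1|]ger0_norm ?subr_ge0 // exprSr mulrA ler_wpM2r ?subr_ge0 //.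
rewrite -mulrA ler_wpM2l //; apply: (le_trans (HK c _)).
  by rewrite c1 (le_trans ca).
by rewrite ler_wpM2l // lerXn2r ?nnegrE ?subr_ge0 // lerD2r.
Qed.

Lemma gbinomial0 (R : realFieldType) (s : R) : gbinomial s 0 = 1.
Proof. by rewrite /gbinomial big_ord0 divr1. Qed.

Lemma gbinomial1 (R : realFieldType) (s : R) : gbinomial s 1 = s.
Proof. by rewrite /gbinomial big_ord1 subr0 divr1. Qed.

(** * The sampled matrix *)

Lemma cvg_mulmx (R : realType) T (F : set_system T) (FF : Filter F) m n p
    (A_ : T -> 'M[R]_(m, n)) (B_ : T -> 'M[R]_(n, p)) (A : 'M[R]_(m, n))
    (B : 'M[R]_(n, p)) :
  (forall i j, A_ x i j @[x --> F] --> A i j) ->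
  (forall i j, B_ x i j @[x --> F] --> B i j) ->
  forall i j, (A_ x *m B_ x) i j @[x --> F] --> (A *m B) i j.
Proof.
move=> cA cB i j; under eq_cvg do rewrite mxE.
rewrite mxE; apply: cvg_big => //; first exact: add_continuous.
by move=> k _; exact: cvgM.
Qed.

(** An error of order [o(e ^+ (n + n))] can be absorbed into [G]: stripping [D e] from both sides
    divides entry (i, j) by [e ^+ (i + j)], at most [e ^+ (n + n)]. So [H e = V D (G + F e) D W]
    with [F e] tending to 0. *)
Lemma near_det_lt0 (R : realType) n (V G W : 'M[R]_n.+1) (H : R -> 'M[R]_n.+1)
    (D := fun e : R => diag_mx (\row_(j < n.+1) e ^+ j)) :
  0 < \det V * \det W -> \det G < 0 ->
  (forall i j, (H e - V *m D e *m G *m D e *m W) i j / e ^+ (n + n)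
     @[e --> 0^'+] --> (0 : R)) ->
  \forall e \near 0^'+, \det (H e) < 0.
Proof.
move=> VWpos Gneg Hlim.
have /andP[Vu Wu] : (V \in unitmx) && (W \in unitmx).
  by rewrite !unitmxE !unitfE -negb_or -mulf_eq0 gt_eqF.
pose E e := (e ^+ (n + n))^-1 *: (H e - V *m D e *m G *m D e *m W).
pose X e := invmx V *m E e *m invmx W.
pose F e := \matrix_(i, j) (e ^+ (n - i) * e ^+ (n - j) * X e i j).
have XF e : D e *m F e *m D e = e ^+ (n + n) *: X e.
  rewrite mul_diag_mx mul_mx_diag; apply/matrixP => i j; rewrite !mxE.
  have eD (l : 'I_n.+1) : e ^+ n = e ^+ l * e ^+ (n - l).
    by rewrite -exprD subnKC // -ltnS.
  by rewrite exprD {1}(eD i) (eD j); ring.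
have HE e : e != 0 -> H e = V *m (D e *m (G + F e) *m D e) *m W.
  move=> e0; rewrite mulmxDr mulmxDl XF mulmxDr mulmxDl.
  rewrite -scalemxAr -scalemxAl /X !mulmxA mulmxV // mul1mx mulmxKV //.
  by rewrite /E scalerA mulfV ?expf_neq0 // scale1r addrC subrK.
have X0 i j : X e i j @[e --> 0^'+] --> (0 : R).
  suff : X e i j @[e --> 0^'+] --> (invmx V *m 0 *m invmx W) i j.
    by rewrite mulmx0 mul0mx mxE.
  apply: cvg_mulmx => k l; last exact: cvg_cst.
  apply: cvg_mulmx => {}k {}l; first exact: cvg_cst.
  by under eq_cvg do rewrite mxE mulrC; rewrite mxE; exact: Hlim.
have GF i j : (G + F e) i j @[e --> 0^'+] --> G i j.
  suff F0 : F e i j @[e --> 0^'+] --> (0 : R).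
    suff : G i j + F e i j @[e --> 0^'+] --> G i j + 0.
      by rewrite addr0 => GF0; under eq_cvg do rewrite mxE.
    by apply: cvgD => //; exact: cvg_cst.
  suff : F e i j @[e --> 0^'+] --> (0 : R) ^+ (n - i) * 0 ^+ (n - j) * 0.
    by rewrite mulr0.
  under eq_cvg do rewrite mxE.
  apply: cvgM => //; apply: cvg_at_right_filter.
  by apply: cvgM; apply: exprn_continuous.
have GFneg := cvgr_lt _ (cvg_det _ GF) _ Gneg.
near=> e.
have e0 : 0 < e by near: e; exact: nbhs_right_gt.
have De : 0 < \det (D e).
  by rewrite det_diag prodr_gt0 // => j _; rewrite mxE exprn_gt0.
rewrite HE ?gt_eqF // !det_mulmx.
have GFe : \det (G + F e) < 0 by near: e; exact: GFneg.
suff -> : \det V * (\det (D e) * \det (G + F e) * \det (D e)) * \det W =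
    (\det V * \det W) * (\det (D e) * \det (D e)) * \det (G + F e).
  by rewrite pmulr_rlt0 // mulr_gt0 // mulr_gt0.
ring.
Unshelve. all: by end_near. Qed.

(** The subtracted polynomial collects the terms of F(e x, e y)^t of degree at most 3 in each
    variable. The base is 1 + O(e^2), so four Taylor terms leave an error O(e^8). *)
Lemma powR_entry_cvg (R : realType) (t N x y : R) : 0 < x -> 0 < y ->
  ((1 + e ^+ 2 * (x * y)
     + e ^+ 4 * ((x ^+ 2 - e * x ^+ 3) * (y ^+ 2 + e * N * y ^+ 3))
     + e ^+ 6 * (x ^+ 3 * y ^+ 3)) `^ t
   - (1 + e ^+ 2 * (t * (x * y))
      + e ^+ 4 * ((t + gbinomial t 2) * (x ^+ 2 * y ^+ 2))
      + e ^+ 5 * (t * N * (x ^+ 2 * y ^+ 3) - t * (x ^+ 3 * y ^+ 2))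
      + e ^+ 6 * ((t * (1 - N) + gbinomial t 2 *+ 2 + gbinomial t 3)
                  * (x ^+ 3 * y ^+ 3))))
   / e ^+ 6 @[e --> 0^'+] --> (0 : R).
Proof.
move=> x0 y0; have [K K0 taylor] := powR_taylor 4 t.
pose p := x * y.
pose c1 := N * (x ^+ 2 * y ^+ 3) - x ^+ 3 * y ^+ 2.
(* As polynomials in e, the base of the power is [1 + 'X^2 * b], with [b = p%:P + 'X^2 * c]. *)
pose c2 := (1 - N) * (x ^+ 3 * y ^+ 3).
pose c : {poly R} := (p ^+ 2)%:P + c1%:P * 'X + c2%:P * 'X^2.
pose b : {poly R} := p%:P + 'X^2 * c.
(* [q] is the Taylor sum minus the subtracted polynomial, divided by e^6. The second summand of [u]
   is the remainder bound K (e^2 b)^4 divided by e^6. The factors ['X] make both vanish at 0. *)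
pose q : {poly R} := 'X * ((gbinomial t 2)%:P *
    ((2 * p)%:P * (c1%:P + c2%:P * 'X) + 'X * c ^+ 2)
  + (gbinomial t 3)%:P * ((3 * p ^+ 2)%:P * 'X * c
      + (3 * p)%:P * 'X^3 * c ^+ 2 + 'X^5 * c ^+ 3)).
pose u (e : R) : R := `|q.[e]| + ('X * (K%:P * 'X * b ^+ 4)).[e].
have cu : continuous u.
  move=> z; apply: cvgD; last exact: continuous_horner.
  by apply: cvg_norm; exact: continuous_horner.
have u0 : u 0 = 0.
  by rewrite /u /q ![('X * _).[_]]hornerM !hornerX !mul0r normr0 addr0.
have ulim : u e @[e --> 0^'+] --> u 0.
  by apply: cvg_at_right_filter; exact: cu.
rewrite u0 in ulim.
have b0 : 0 < b.[0].
  by rewrite /b hornerD hornerC hornerM hornerXn expr0n mul0r addr0 mulr_gt0.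
have bpos : \forall e \near 0^'+, 0 < b.[e].
  by apply: (cvgr_gt _ (cvg_at_right_filter (@continuous_horner _ b 0))).
have blt : \forall e \near 0^'+, ('X^2 * b).[e] < 1.
  apply: (cvgr_lt _ (cvg_at_right_filter (@continuous_horner _ ('X^2 * b) 0))).
  by rewrite hornerM hornerXn expr0n mul0r.
apply: norm_cvg0; apply: (squeeze_cvgr _ (cvg_cst 0) ulim).
near=> e; rewrite normr_ge0 /=.
have e0 : 0 < e by near: e; exact: nbhs_right_gt.
have be0 : 0 < b.[e] by near: e; exact: bpos.
have be1 : e ^+ 2 * b.[e] < 1.
  suff : ('X^2 * b).[e] < 1 by rewrite hornerM hornerXn.
  by near: e; exact: blt.
have e20 : 0 < e ^+ 2 * b.[e] by rewrite mulr_gt0 // exprn_gt0.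
have cE : c.[e] = p ^+ 2 + c1 * e + c2 * e ^+ 2 by rewrite !hornerE.
have bE : b.[e] = p + e ^+ 2 * c.[e] by rewrite /b !hornerE.
set Z := (X in X `^ t); have -> : Z = 1 + e ^+ 2 * b.[e].
  by rewrite bE cE /Z /p /c1 /c2; ring.
set L := (X in _ - X).
have := taylor (1 + e ^+ 2 * b.[e]).
rewrite [_ - 1]addrC addKr.
set S := \sum_(_ < _) _ => /(_ _) tay.
have SL : S - L = q.[e] * e ^+ 6.
  rewrite /S /L !big_ord_recr big_ord0 /= gbinomial0 gbinomial1.
  have -> : q.[e] = e * (gbinomial t 2 *
      (2 * p * (c1 + c2 * e) + e * c.[e] ^+ 2)
    + gbinomial t 3 * (3 * p ^+ 2 * e * c.[e]
      + 3 * p * e ^+ 3 * c.[e] ^+ 2 + e ^+ 5 * c.[e] ^+ 3)).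
    by rewrite /q !hornerE.
  rewrite bE cE /p /c1 /c2; ring.
rewrite normrM [`|_^-1|]ger0_norm ?invr_ge0 ?exprn_ge0 ?(ltW e0) //.
rewrite ler_pdivrMr ?exprn_gt0 // -[_ - L](subrKA S) SL.
apply: le_trans (ler_normD _ _) _.
rewrite normrM [`|e ^+ 6|]ger0_norm ?exprn_ge0 ?(ltW e0) //.
rewrite /u mulrDl addrC lerD2l.
have -> : ('X * (K%:P * 'X * b ^+ 4)).[e] * e ^+ 6 = K * (e ^+ 2 * b.[e]) ^+ 4.
  by rewrite !(horner_exp, hornerM, hornerX, hornerC); ring.
by apply: tay; lra.
Unshelve. all: by end_near. Qed.

(* Coefficients of u^i v^j in F(u, v)^t. *)
Definition coef_mx (R : realType) (t N : R) : 'M[R]_4 :=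
  \matrix_(i, j) nth 0 (nth [::]
    [:: [:: 1; 0; 0; 0];
        [:: 0; t; 0; 0];
        [:: 0; 0; t + gbinomial t 2; t * N];
        [:: 0; 0; - t; t * (1 - N) + gbinomial t 2 *+ 2 + gbinomial t 3]] i) j.

Lemma det_coef_mx (R : realType) (t N : R) : \det (coef_mx t N) =
  t * ((t + gbinomial t 2) * (t + gbinomial t 2 *+ 2 + gbinomial t 3)
       - t * gbinomial t 2 * N).
Proof.
rewrite (expand_det_row _ ord0) !big_ord_recl big_ord0 !mxE /= !mul0r !addr0.
rewrite mul1r /cofactor /= expr0 mul1r.
rewrite (expand_det_row _ ord0) !big_ord_recl big_ord0 !mxE /= !mul0r !addr0.
rewrite /cofactor /= expr0 mul1r.
rewrite (expand_det_row _ ord0) !big_ord_recl big_ord0 !mxE /= addr0.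
rewrite /cofactor /= !det_mx11 !mxE /=.
ring.
Qed.

Lemma coef_mx_neg (R : realType) (t : R) : 1 < t ->
  exists N, \det (coef_mx t N) < 0.
Proof.
move=> t1; have t0 : 0 < t := lt_trans ltr01 t1.
have g0 : 0 < t * gbinomial t 2.
  rewrite mulr_gt0 // /gbinomial !big_ord_recr big_ord0 /= mul1r subr0.
  by rewrite divr_gt0 // mulr_gt0 // subr_gt0.
(* This [N] makes the factor multiplying [t] in [det_coef_mx] equal to -1. *)
exists (((t + gbinomial t 2) * (t + gbinomial t 2 *+ 2 + gbinomial t 3) + 1)
  / (t * gbinomial t 2)).
rewrite det_coef_mx pmulr_rlt0 // [X in _ - X]mulrCA divff ?gt_eqF //; lra.
Qed.

(* The columns are 1, u, u^2 - u^3, u^3 at u = e x_i, rescaled by e^-j, and the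
   rows of [right_mx x (e * N)] are 1, v, v^2 + N v^3, v^3 at v = e x_j,
   rescaled by e^-i. *)
Definition left_mx (R : realType) (x : nat -> R) (e : R) : 'M[R]_4 :=
  \matrix_(i, j) (x i ^+ j - e * (x i ^+ 3 *+ (j == 2 :> nat))).

Definition right_mx (R : realType) (x : nat -> R) (e : R) : 'M[R]_4 :=
  \matrix_(i, j) (x j ^+ i + e * (x j ^+ 3 *+ (i == 2 :> nat))).

Lemma totally_positive_power4 (R : realType) (t : R) : 1 < t ->
  exists2 A : 'M[R]_4, totally_positive A & \det (hadamard_power A t) < 0.
Proof.
move=> t1; have [N Nneg] := coef_mx_neg t1.
have [x xpos] := tp_nat_vandermonde R 4 4.
rewrite /tp_nat in xpos; set V := (X in totally_positive X) in xpos.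
(* The nodes are the entries of column 1 of the Vandermonde matrix, hence 1 x 1 minors. *)
have x0 (i : 'I_4) : 0 < x i.
  have := xpos 1 (fun=> i) (fun=> inord 1).
  rewrite det_mx11 !mxE inordK // expr1.
  by apply => k l; rewrite !ord1.
have idi : strictly_increasing (id : 'I_4 -> 'I_4) by [].
have detV : 0 < \det V.
  by have := xpos 4 id id idi idi; rewrite mxsub_id.
(* The exponent [j + j] restores the factors e^-j removed from both [left_mx] and [right_mx], so
   that [A e] has entries F(e x_i, e x_j). *)
pose D2 (e : R) : 'rV[R]_4 := \row_j e ^+ (j + j).
pose A e := left_mx x e *m diag_mx (D2 e) *m right_mx x (e * N).
have AE e i j : A e i j = 1 + e ^+ 2 * (x i * x j)
     + e ^+ 4 * ((x i ^+ 2 - e * x i ^+ 3) * (x j ^+ 2 + e * N * x j ^+ 3))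
     + e ^+ 6 * (x i ^+ 3 * x j ^+ 3).
  rewrite /A mul_mx_diag !mxE !big_ord_recr big_ord0 /= !mxE /=; ring.
have Ltp : \forall e \near 0^'+, totally_positive (left_mx x e).
  apply: near_cvg_totally_positive xpos => i j; apply: cvg_at_right_filter.
  under eq_cvg do rewrite mxE; rewrite mxE.
  suff : (x i ^+ j - e * (x i ^+ 3 *+ (j == 2 :> nat))) @[e --> 0] -->
      x i ^+ j - 0 * (x i ^+ 3 *+ (j == 2 :> nat)) by rewrite mul0r subr0.
  apply: cvgB; first exact: cvg_cst.
  by apply: cvgM; [exact: cvg_id|exact: cvg_cst].
have Rtp : \forall e \near 0^'+, totally_positive (right_mx x (e * N)).
  apply: near_cvg_totally_positive (totally_positive_tr xpos) => i j.
  apply: cvg_at_right_filter.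
  under eq_cvg do rewrite mxE; rewrite !mxE.
  suff : (x j ^+ i + e * N * (x j ^+ 3 *+ (i == 2 :> nat))) @[e --> 0] -->
      x j ^+ i + 0 * N * (x j ^+ 3 *+ (i == 2 :> nat)) by rewrite !mul0r addr0.
  apply: cvgD; first exact: cvg_cst.
  by apply: cvgM; [apply: cvgM; [exact: cvg_id|exact: cvg_cst]|exact: cvg_cst].
have Hneg : \forall e \near 0^'+, \det (hadamard_power (A e) t) < 0.
  apply: (@near_det_lt0 _ _ V _ V^T _ _ Nneg) => [|i j].
    by rewrite det_tr mulr_gt0.
  have := powR_entry_cvg t N (x0 i) (x0 j); apply: cvg_trans.
  apply: near_eq_cvg; apply: nearW => e /=.
  congr (_ / _); rewrite [RHS]mxE [X in _ = X + _]mxE [X in _ = _ + X]mxE AE.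
  congr (_ - _); rewrite !mul_mx_diag mxE.
  rewrite !big_ord_recr big_ord0 /= !mxE !big_ord_recr !big_ord0 /= !mxE /=.
  ring.
near (0 : R)^'+ => e.
exists (A e); last by near: e; exact: Hneg.
have e0 : 0 < e by near: e; exact: nbhs_right_gt.
apply: totally_positive_mulmx => //; last by near: e; exact: Rtp.
apply: totally_positive_mul_diag => [j|]; first by rewrite mxE exprn_gt0.
by near: e; exact: Ltp.
Unshelve. all: by end_near. Qed.

Theorem mainTheorem6 (R : realType) (n : nat) (hn : (4 <= n)%N)
    (t : R) (ht : 1 < t) :
  exists A : 'M[R]_n,
    totally_positive A /\
    ~ totally_nonnegative_of_order 4 (hadamard_power A t).
Proof.
have [A Apos Aneg] := totally_positive_power4 ht.
pose a i j := A (inord i) (inord j).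
have apos : tp_nat 4 4 a.
  congr totally_positive: Apos; apply/matrixP => i j.
  by rewrite mxE /a !inord_val.
have [b bpos ba] := tp_nat_extend hn apos.
exists (\matrix_(i < n, j < n) b i j); split => // Ann.
(* The violated inequality is the leading principal 4 x 4 minor of the power. *)
have wi : strictly_increasing (widen_ord hn) by [].
have := Ann 4 _ _ isT wi wi; rewrite leNgt => /negP[].
rewrite [X in \det X](_ : _ = hadamard_power A t) //.
by apply/matrixP => i j; rewrite !mxE ba //= /a !inord_val.
Qed.
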